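(* For every integer $n\ge0$, $$E_6^b(n)=(2n+1)A_5^b(n)=\tfrac15(1+2n)^2(5+27n+71n^2+88n^3+44n^4),$$ $E_6^s(0)=1$, $E_6^s(n)=\tfrac25 n(47+480n^2+528n^4)$ for $n\ge1$, and $$\sum_{n\ge0}E_6^b(n)x^n=\frac{1+416x+5815x^2+12880x^3+5815x^4+416x^5+x^6}{(1-x)^7}.$$
   Context: Let $G$ be the $8\times 6$ matrix whose columns are $c_1=(0,-1,1,0,0,0,0,0)^T$, $c_2=(0,0,-1,1,0,0,0,0)^T$, $c_3=(0,0,0,-1,1,0,0,0)^T$, $c_4=(0,0,0,0,-1,1,0,0)^T$, $c_5=(0,0,0,0,0,-1,1,0)^T$, $c_6=\tfrac12(1,1,1,1,-1,-1,-1,-1)^T$, and let $E_6=G\mathbb{Z}^6\subset\mathbb{R}^8$. For an integer $n\ge0$, $E_6^b(n)$ is the number of points $p\in E_6\cap\mathbb{Z}^8$ with $|p_i|\le n$ for all $i=1,\dots,8$; $E_6^s(0)=1$ and $E_6^s(n)=E_6^b(n)-E_6^b(n-1)$ for $n\ge1$. Here $A_5^b(n)$ denotes the number of $q\in\mathbb{Z}^6$ with $|q_i|\le n$ for all $i$ and $q_1+\dots+q_6=0$. The generating function is a formal power series in $x$. *)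

(* Defs.v *)
From HB Require Import structures.
From mathcomp Require Import all_boot all_order all_algebra.
From Stdlib Require Import ClassicalEpsilon.
Set Implicit Arguments. Unset Strict Implicit. Unset Printing Implicit Defensive.
Import Order.TTheory GRing.Theory Num.Theory.
Local Open Scope ring_scope.

Definition asbool (P : Prop) : bool :=
  if excluded_middle_informative P then true else false.

Definition Gentry (i j : nat) : rat :=
  if (j < 5)%N then
    (if i == j.+1 then -1 else if i == j.+2 then 1 else 0)
  else (if (i < 4)%N then 1 / 2 else - (1 / 2)).

Definition G : 'M[rat]_(8, 6) := \matrix_(i < 8, j < 6) Gentry i j.

Definition inE6 (v : 'cV[rat]_8) : Prop :=
  exists z : 'cV[int]_6, v = G *m map_mx (fun a : int => a%:~R) z.

(* integer point of the box [-n,n]^d encoded by f : 'I_d -> 'I_(2n+1) *)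
Definition boxpt (d n : nat) (f : {ffun 'I_d -> 'I_(2 * n + 1)}) : 'cV[int]_d :=
  \col_i ((f i)%:Z - n%:Z).

Definition E6b (n : nat) : nat :=
  #|[set f : {ffun 'I_8 -> 'I_(2 * n + 1)} |
      asbool (inE6 (map_mx (fun a : int => a%:~R) (boxpt f)))]|.

Definition E6s (n : nat) : int :=
  if n is m.+1 then (E6b n)%:Z - (E6b m)%:Z else 1.

Definition A5b (n : nat) : nat :=
  #|[set f : {ffun 'I_6 -> 'I_(2 * n + 1)} |
      \sum_(i < 6) boxpt f i 0 == 0]|.

Definition E6num : {poly int} :=
  Poly [:: 1; 416; 5815; 12880; 5815; 416; 1].

(* Main.v *)
Require Import Defs.
From HB Require Import structures.
From mathcomp Require Import all_boot all_order all_algebra.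
From mathcomp Require Import ring lra zify.
From Stdlib Require Import ClassicalEpsilon.
Import Order.TTheory GRing.Theory Num.Theory.
Local Open Scope ring_scope.

(** An integral point [v] of the lattice has [v_0 = - v_7 = z_6 / 2], which forces
    [z_6] to be even; then [v_1, ..., v_6] ranges over all integral points with sum
    zero.  Hence the points in the box are the choices of [v_0] times the points of
    [A_5] in the box.  The latter are counted, after a shift by [n], by the
    coefficient of [X^(6n)] in [((1 - X^(2n+1)) / (1 - X))^6], and the rest
    is polynomial algebra. *)

Lemma coef_sumXn_exp (R : comNzRingType) (d m N : nat) :
  ((\sum_(i < m) 'X^i) ^+ d : {poly R})`_N =
  #|[set f : {ffun 'I_d -> 'I_m} | (\sum_i f i)%N == N]|%:R.
Proof.
have -> : (\sum_(i < m) 'X^i) ^+ d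
    = \prod_(k < d) \sum_(i < m) 'X^i :> {poly R}.
  by rewrite prodr_const card_ord.
rewrite bigA_distr_bigA /= coef_sum -sum1dep_card natr_sum [RHS]big_mkcond /=.
apply: eq_bigr => f _.
by rewrite prodrXr coefXn eq_sym; case: eqP.
Qed.

(** Truncated form of the series [1 / (1 - X)^(d+1)]: the error ['X^N * Q] does not reach the
    coefficients below [N], so no power series are needed. *)
Lemma binomial_series_inv (R : comNzRingType) (d N : nat) :
  exists Q : {poly R},
    (1 - 'X) ^+ d.+1 * \poly_(k < N) 'C(k + d, d)%:R = 1 + 'X^N * Q.
Proof.
elim: d => [|d [Q IH]].
  exists (-1); rewrite expr1.
  have -> : \poly_(k < N) 'C(k + 0, 0)%:R = \sum_(k < N) 'X^k :> {poly R}.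
    by rewrite poly_def; apply: eq_bigr => i _; rewrite bin0 scale1r.
  by rewrite -opprB mulNr -subrX1 mulrN1 opprB.
(* By Pascal's rule, multiplying by [1 - 'X] lowers [d] by one, except in degree [N], where the last
   coefficient of the truncation survives as [c]; for [N = 0] the truncation is empty. *)
pose c : R := if N is M.+1 then 'C(M + d.+1, d.+1)%:R else 0.
have E : (1 - 'X) * \poly_(k < N) 'C(k + d.+1, d.+1)%:R
    = \poly_(k < N) 'C(k + d, d)%:R - 'X^N * c%:P.
  apply/polyP => k.
  rewrite mulrBl mul1r !coefB. rewrite coefXM coefXnM coefC !coef_poly.
  case: k => [|k] /=.
    rewrite /c; case: N {IH c} => [|M] /=; first by rewrite !subr0.
    by rewrite !add0n !binn.
  case: (ltngtP k.+1 N) => [lt|lt|eN].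
  - by rewrite [in RHS]addSnnS [in LHS]addSn binS natrD addrAC subrr add0r subr0.
  - by rewrite subn_eq0 leqNgt lt.
  - by rewrite /c -eN subnn eqxx.
exists (Q - (1 - 'X) ^+ d.+1 * c%:P).
rewrite exprSr -mulrA E mulrBr IH; ring.
Qed.

(** Inclusion-exclusion on the summands that reach [m], read off from
    [(1 - X^m)^(d+1) / (1 - X)^(d+1)]. The guard on [j] keeps the subtraction in [nat] exact. *)
Lemma card_bounded_sum (d m N : nat) :
  #|[set f : {ffun 'I_d.+1 -> 'I_m} | (\sum_i f i)%N == N]|%:R =
  \sum_(j < d.+2 | (m * j <= N)%N)
    (-1) ^+ j * 'C(d.+1, j)%:R * 'C(N - m * j + d, d)%:R :> int.
Proof.
rewrite -coef_sumXn_exp; set S := \sum_(i < m) _.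
have [Q EQ] := binomial_series_inv int d N.+1.
set P := \poly_(k < _) _ in EQ.
have -> : (S ^+ d.+1)`_N = ((1 - 'X^m) ^+ d.+1 * P)`_N.
  have -> : (1 - 'X^m) = (1 - 'X) * S :> {poly int}.
    by rewrite -opprB subrX1 -mulNr opprB.
  rewrite exprMn mulrAC EQ mulrDl mul1r coefD -mulrA coefXnM.
  by rewrite ltnSn addr0.
rewrite exprBn mulr_suml coef_sum [RHS]big_mkcond /=.
apply: eq_bigr => j _.
rewrite expr1n mulr1 -exprM -mulrnAl -mulrA [_ *+ _ * _]mulrC -mulrA coefXnM.
have -> : (-1) ^+ j *+ 'C(d.+1, j) = ((-1) ^+ j * 'C(d.+1, j)%:R)%:P :> {poly int}.
  by rewrite polyCM polyCMn rmorphXn /= polyCN mulr_natr.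
rewrite ltnNge; case: leqP => //= le.
rewrite coefCM coef_poly (_ : (_ < _)%N) ?mulrA //; lia.
Qed.

Lemma asboolE (P : Prop) (b : bool) : (P <-> b) -> asbool P = b.
Proof. by rewrite /asbool; case: excluded_middle_informative; case: b; intuition. Qed.

Lemma inE6_intP (v : 'cV[int]_8) :
  inE6 (map_mx (fun a : int => a%:~R) v) <->
  v ord0 0 + v ord_max 0 = 0 /\ \sum_(i < 6) v (lift ord0 (lift ord_max i)) 0 = 0.
Proof.
(* With entries indexed by [nat], positions become closed numerals once the sums are unfolded. *)
pose v' (k : nat) := v (inord k) 0.
have Ev (i : 'I_8) : v i 0 = v' i by rewrite /v' inord_val.
have -> : \sum_(i < 6) v (lift ord0 (lift ord_max i)) 0 = \sum_(i < 6) v' i.+1.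
  apply: eq_bigr => i _; rewrite Ev lift0 /= /bump.
  by rewrite leqNgt ltn_ord.
rewrite !Ev !big_ord_recl big_ord0 /= /bump /=.
split=> [[z] | [e1 e2]].
  pose w (k : nat) := z (inord k) 0.
  move/matrixP => E.
  have {}E k : (k < 8)%N ->
      (v' k)%:~R = \sum_(j < 6) Gentry k j * (w j)%:~R :> rat.
    move=> lt; have := E (Ordinal lt) 0; rewrite !mxE Ev /= => ->.
    by apply: eq_bigr => j _; rewrite !mxE /w inord_val.
  have := (E 0 isT, E 1 isT, E 2 isT, E 3 isT, (E 4 isT, E 5 isT, E 6 isT, E 7 isT)).
  rewrite !big_ord_recl !big_ord0 /Gentry /= /bump /=.
  move=> [] [] [] [] h0 h1 h2 h3 [] [] [] h4 h5 h6 h7.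
  split; apply: (@intr_inj rat); rewrite !rmorphD /= ?h0 ?h1 ?h2 ?h3 ?h4 ?h5 ?h6 ?h7; ring.
(* Back-substitution in [v = G z], starting from [z_6 = 2 v_0]. *)
pose m := v' 0.
pose w := [:: m - v' 1; 2 * m - v' 1 - v' 2; 3 * m - v' 1 - v' 2 - v' 3;
  2 * m - v' 1 - v' 2 - v' 3 - v' 4; m - v' 1 - v' 2 - v' 3 - v' 4 - v' 5;
  2 * m].
exists (\col_j w`_j); apply/matrixP => i j; rewrite (ord1 j) !mxE Ev.
under eq_bigr => k _ do rewrite !mxE.
rewrite !big_ord_recl !big_ord0 /Gentry /= /bump /=.
have e7 : v' 7 = - v' 0 by lra.
have e6 : v' 6 = - v' 1 - v' 2 - v' 3 - v' 4 - v' 5 by lra.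
by case: i => [] [|[|[|[|[|[|[|[|//]]]]]]]] lt /=; rewrite ?e7 ?e6 /m; field.
Qed.

Lemma E6bE (n : nat) : E6b n = ((2 * n + 1) * A5b n)%N.
Proof.
(* Glues the first coordinate and the six middle ones; as the box is shifted by [n], negation in the
   last coordinate is [rev_ord], that is [k] to [2n - k]. *)
pose g (u : 'I_(2 * n + 1) * {ffun 'I_6 -> 'I_(2 * n + 1)})
    : {ffun 'I_8 -> 'I_(2 * n + 1)} :=
  [ffun i => if unlift ord0 i is Some i' then
    if unlift ord_max i' is Some i'' then u.2 i'' else rev_ord u.1 else u.1].
have g0 u : g u ord0 = u.1 by rewrite ffunE unlift_none.
have gmax u : g u ord_max = rev_ord u.1.
  have -> : ord_max = lift ord0 ord_max :> 'I_8 by apply: val_inj.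
  by rewrite ffunE liftK unlift_none.
have gmid u i : g u (lift ord0 (lift ord_max i)) = u.2 i.
  by rewrite ffunE !liftK.
have g_inj : injective g.
  move=> [a h] [a' h'] e; congr pair.
    by have := g0 (a, h); rewrite e g0.
  by apply/ffunP => i; have := gmid (a, h) i; rewrite e gmid.
set A := [set f : {ffun 'I_6 -> 'I_(2 * n + 1)} | \sum_(i < 6) boxpt f i 0 == 0].
have -> : ((2 * n + 1) * A5b n)%N = #|g @: setX setT A|.
  by rewrite (card_imset _ g_inj) cardsX cardsT card_ord.
apply: eq_card => f; rewrite inE.
apply: asboolE; rewrite inE6_intP; split=> [[e1 e2]|].
  apply/imsetP.
  exists (f ord0, [ffun i => f (lift ord0 (lift ord_max i))]).
    rewrite !inE /= -[X in _ == X]e2; apply/eqP/eq_bigr => i _.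
    by rewrite !mxE ffunE.
  apply/ffunP => i.
  case: (unliftP ord0 i) => [i' ->|->]; last by rewrite g0.
  case: (unliftP ord_max i') => [i'' ->|->]; first by rewrite gmid ffunE.
  have -> : lift ord0 ord_max = ord_max :> 'I_8 by apply: val_inj.
  rewrite gmax; apply: val_inj => /=.
  move: e1; rewrite !mxE; have := ltn_ord (f ord0); lia.
case/imsetP => [[a h]]; rewrite !inE /= => /eqP hA ->; split.
  by rewrite !mxE g0 gmax /=; have := ltn_ord a; lia.
by rewrite -[RHS]hA; apply: eq_bigr => i _; rewrite !mxE gmid.
Qed.

Lemma A5b_card (n : nat) :
  A5b n = #|[set f : {ffun 'I_6 -> 'I_(2 * n + 1)} | (\sum_i f i)%N == (6 * n)%N]|.
Proof.
apply: eq_card => f; rewrite !inE.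
have -> : \sum_(i < 6) boxpt f i 0 = (\sum_i f i)%:R - (6 * n)%:R.
  transitivity (\sum_(i < 6) ((f i)%:R - n%:R : int)).
    by apply: eq_bigr => i _; rewrite !mxE !natz.
  by rewrite sumrB sumr_const card_ord natr_sum -mulrnA [(n * 6)%N]mulnC.
by rewrite subr_eq0 eqr_nat.
Qed.

Lemma natr_bin5 (F : numFieldType) (k : nat) :
  'C(k + 5, 5)%:R =
  (k%:R + 1) * (k%:R + 2) * (k%:R + 3) * (k%:R + 4) * (k%:R + 5) / 120 :> F.
Proof.
have e : ('C(k + 5, 5) * 120 = (k + 5) * ((k + 4) * ((k + 3) * ((k + 2) * (k + 1)))))%N.
  by rewrite -[120%N]/(5`!) bin_ffact !ffactnS ffactn0 !addnS addn0 /= muln1.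
apply: (@mulIf _ 120%:R); first by rewrite pnatr_eq0.
by rewrite -natrM e !natrM !natrD; field.
Qed.

(** For side [n.+1] exactly the terms [j = 0, 1, 2] satisfy [(2n+3)j <= 6n+6]. Side 0 keeps only
    [j = 0] and is treated apart. *)
Lemma A5b_bin (n : nat) :
  (A5b n.+1)%:R = 'C(6 * n + 6 + 5, 5)%:R - 6 * 'C(4 * n + 3 + 5, 5)%:R
    + 15 * 'C(2 * n + 5, 5)%:R :> int.
Proof.
rewrite A5b_card card_bounded_sum big_mkcond !big_ord_recl big_ord0.
rewrite /= /bump /= !add1n muln0 subn0.
have bnd j : ((2 * n.+1 + 1) * j <= 6 * n.+1)%N = (j < 3)%N by nia.
rewrite !bnd /= (_ : 'C(6, 2) = 15)%N // bin0 bin1.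
rewrite (_ : 6 * n.+1 = 6 * n + 6)%N; last lia.
rewrite (_ : 6 * n + 6 - (2 * n.+1 + 1) * 1 = 4 * n + 3)%N; last lia.
rewrite (_ : 6 * n + 6 - (2 * n.+1 + 1) * 2 = 2 * n)%N; last lia.
by ring.
Qed.

Lemma A5b_rat (n : nat) :
  (A5b n)%:R = 1 / 5 * (1 + 2 * n%:R) *
    (5 + 27 * n%:R + 71 * n%:R ^+ 2 + 88 * n%:R ^+ 3 + 44 * n%:R ^+ 4) :> rat.
Proof.
case: n => [|n].
  have -> : A5b 0 = 1%N; last by field.
  apply/eqP; rewrite A5b_card -(eqr_nat int) card_bounded_sum big_mkcond.
  by rewrite !big_ord_recl big_ord0.
have /(congr1 (fun z : int => z%:~R : rat)) := A5b_bin n.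
rewrite rmorphD rmorphB !rmorphM /= !rmorph_nat !natr_bin5 => ->.
by field.
Qed.

Lemma E6b_rat (n : nat) :
  (E6b n)%:R = 1 / 5 * (1 + 2 * n%:R) ^+ 2 *
    (5 + 27 * n%:R + 71 * n%:R ^+ 2 + 88 * n%:R ^+ 3 + 44 * n%:R ^+ 4) :> rat.
Proof. by rewrite E6bE natrM A5b_rat natrD natrM; field. Qed.

Theorem mainTheorem12 :
  (forall n : nat,
      (E6b n)%:R = ((2 * n + 1) * A5b n)%:R :> rat /\
      (E6b n)%:R = 1 / 5 * (1 + 2 * n%:R) ^+ 2 *
        (5 + 27 * n%:R + 71 * n%:R ^+ 2 + 88 * n%:R ^+ 3 + 44 * n%:R ^+ 4) :> rat) /\
  E6s 0 = 1 /\
  (forall n : nat, (1 <= n)%N ->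
      (E6s n)%:~R = 2 / 5 * n%:R * (47 + 480 * n%:R ^+ 2 + 528 * n%:R ^+ 4) :> rat) /\
  (* formal power series identity (1-x)^7 * sum_n E6b(n) x^n = numerator,
     stated coefficientwise: coefficient N only involves E6b 0..N *)
  (forall N : nat,
      (((1 - 'X) ^+ 7 * \poly_(k < N.+1) (E6b k)%:R : {poly int})`_N
       = E6num`_N)).
Proof.
split; first by move=> n; rewrite {1}E6bE E6b_rat.
split; first by [].
split=> [[//|n] _|N].
  by rewrite rmorphB /= -!pmulrn !E6b_rat -natr1; field.
(* Clearing the denominator keeps the closed form in [int], where the series identity lives. *)
have e k : 5 * (E6b k)%:R = (1 + 2 * k%:R) ^+ 2 *
    (5 + 27 * k%:R + 71 * k%:R ^+ 2 + 88 * k%:R ^+ 3 + 44 * k%:R ^+ 4) :> int.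
  by apply: (@intr_inj rat); rewrite rmorphM /= [X in _ * X]rmorph_nat E6b_rat; field.
have -> : (1 - 'X) ^+ 7 = 1 - 7%:R *: 'X + 21%:R *: 'X^2 - 35%:R *: 'X^3
    + 35%:R *: 'X^4 - 21%:R *: 'X^5 + 7%:R *: 'X^6 - 'X^7 :> {poly int}.
  rewrite !scaler_nat; ring.
rewrite !(mulrDl, mulNr) mul1r -!scalerAl !(coefD, coefN, coefZ) coefXM !coefXnM.
rewrite coef_Poly !coef_poly.
(* From degree 7 on, the coefficient is the seventh difference of a polynomial of degree 6 in the
   index, hence zero; the degrees below 7 are numerical checks. *)
case: N => [|[|[|[|[|[|[|N]]]]]]]; last first.
  rewrite !ltnS /= !subSS !subn0 nth_nil !ifT; try lia.
  move: (e N) (e N.+1) (e N.+2) (e N.+3) (e N.+4) (e N.+4.+1) (e N.+4.+2) (e N.+4.+3).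
  lra.
all: move: (e 0) (e 1) (e 2) (e 3) (e 4) (e 5) (e 6) => /=; lra.
Qed.
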